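(* Let $(\mathcal X,(\|\cdot\|_k)_{k\in\mathbb N})$ and $(\mathcal Y,(|\cdot|_k)_{k\in\mathbb N})$ be graded Fréchet spaces, $x_0\in\mathcal X$, $R=(r_k)_{k\in\mathbb N}$ with $r_k\in\mathbb R_{>0}\cup\{+\infty\}$, and let $L,L_S,L_D\in\mathbb N$, $\alpha_k\in(0,1)$, $\sigma_k>0$, $\delta_k>0$ and $\alpha_{kn}>0$ ($k,n\in\mathbb N$) be constants. Set $$\bar r_{k+L_D}:=\frac{r_{k+L}(1-\alpha_k)}{\delta_{k+L_D}},\qquad \bar R:=(\bar r_{k+L_D})_{k\in\mathbb N}.$$ Let $D:\mathcal Y\to\mathcal X$ and $S:\mathcal X\to\mathcal Y$ be linear maps, let $f:\bar B_R(x_0)\to\mathcal Y$, and set $P_y(x):=x-D[f(x)-y]$ for all $y\in\bar B_{\bar R}(f(x_0))$ and $x\in\bar B_R(x_0)$. Assume that for all $k\in\mathbb N$: (i) $\|D(f(x))-D(f(\bar x))-(x-\bar x)\|_k\le\alpha_k\|x-\bar x\|_{k+L}$ for all $x,\bar x\in\bar B_R(x_0)$; (ii) $S\circ D=1_{\mathcal Y}$; (iii) $|S(x)-S(\bar x)|_k\le\sigma_k\|x-\bar x\|_{k+L_S}$ for all $x,\bar x\in\mathcal X$; (iv) $\|D(y)-D(\bar y)\|_k\le\delta_{k+L_D}|y-\bar y|_{k+L_D}$ for all $y,\bar y\in\mathcal Y$; (v) $\|P_y^{n+1}(x_0)-P_y^n(x_0)\|_k\le\alpha_{kn}\|P_y(x_0)-x_0\|_{k+nL}$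 for all $n\in\mathbb N$ and all $y\in\bar B_{\bar R}(f(x_0))$; (vi) $P_y^n(x_0)\in\bar B_R(x_0)$ for all $n\in\mathbb N$ and all $y\in\bar B_{\bar R}(f(x_0))$; (vii) $\sum_{n=0}^{+\infty}\alpha_{kn}\|P_y(x_0)-x_0\|_{k+nL}<+\infty$ for all $y\in\bar B_{\bar R}(f(x_0))$. Then: (viii) $|f(x)-f(\bar x)|_k\le\sigma_k\left(\alpha_{k+L_S}\|x-\bar x\|_{k+L_S+L}+\|x-\bar x\|_{k+L_S}\right)$ for all $k\in\mathbb N$ and $x,\bar x\in\bar B_R(x_0)$; (ix) $|f(x)-f(\bar x)|_{k+L_D}\ge\frac1{\delta_{k+L_D}}\left(\|x-\bar x\|_k-\alpha_k\|x-\bar x\|_{k+L}\right)$ for all $k\in\mathbb N$ and $x,\bar x\in\bar B_R(x_0)$; (x) for every $y\in\bar B_{\bar R}(f(x_0))$ there exists $x\in\bar B_R(x_0)$ such that $f(x)=y$; (xi) if $g:\bar B_{\bar R}(f(x_0))\to\bar B_R(x_0)$ is any right inverse of $f$, i.e. $f(g(y))=y$ for all $y\in\bar B_{\bar R}(f(x_0))$, and $(\mathcal X,(\|\cdot\|_k)_{k\in\mathbb N})=(\mathcal X,\|\cdot\|)$ is a Banach space (i.e. $\|\cdot\|_k=\|\cdot\|$ for all $k$), then $\|g(y)-g(\bar y)\|\le\frac{\delta_{k+L_D}}{1-\alpha_k}|y-\bar y|_{k+L_D}$ for all $k\in\mathbb N$ and $y,\bar y\in\bar B_{\bar R}(f(x_0))$.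 In particular: 1) if $r_{k+L}\le r_k$ for all $k\in\mathbb N$, then $P_y$ maps $\bar B_R(x_0)$ into $\bar B_R(x_0)$ for all $y\in\bar B_{\bar R}(f(x_0))$, and hence assumption (vi) always holds (it need not be assumed); 2) if we set $\alpha_{kn}:=\prod_{j=0}^{n-1}\alpha_{k+jL}$, then assumption (v) always holds (it need not be assumed).
   Context: $\mathbb N=\{0,1,2,\dots\}$. A graded Fréchet space $(\mathcal F,(\|\cdot\|_k)_{k\in\mathbb N})$ is a Hausdorff, complete topological vector space whose topology is defined by an increasing sequence of seminorms: $\|\cdot\|_k\le\|\cdot\|_{k+1}$ for all $k$. For $x_0\in\mathcal X$ and $R=(r_k)_{k\in\mathbb N}$ with $r_k\in\mathbb R_{>0}\cup\{+\infty\}$, $\bar B_R(x_0):=\{x\in\mathcal X\mid\forall k\in\mathbb N:\ \|x_0-x\|_k\le r_k\}$. Likewise, for the sequence $\bar R=(\bar r_{k+L_D})_{k\in\mathbb N}$, $\bar B_{\bar R}(f(x_0)):=\{y\in\mathcal Y\mid\forall k\in\mathbb N:\ |f(x_0)-y|_{k+L_D}\le\bar r_{k+L_D}\}$. If $r_{k+L}=+\infty$ then $\bar r_{k+L_D}=+\infty$. *)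

(* Defs.v *)
From mathcomp Require Import all_boot all_order all_algebra.
From mathcomp Require Import all_classical all_reals all_analysis.

Set Implicit Arguments.
Unset Strict Implicit.
Unset Printing Implicit Defensive.

Import Order.TTheory GRing.Theory Num.Theory.
Import numFieldNormedType.Exports.

Local Open Scope classical_set_scope.
Local Open Scope ring_scope.

Definition seminorm (R : realType) (X : lmodType R) (p : X -> R) : Prop :=
  [/\ forall x, 0 <= p x,
      forall x y, p (x + y) <= p x + p y &
      forall (a : R) x, p (a *: x) = `|a| * p x].

(* Cauchy filters and completeness refer to the translation-invariant
   uniformity, which is determined by the topology of [X]; the uniform
   structure of the library's [tvsType] is not required to be this one. *)
Definition tvs_cauchy (R : realType) (X : topologicalLmodType R)
    (F : set_system X) : Prop :=
  forall U : set X, nbhs 0 U ->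
    exists2 A, F A & forall x y, A x -> A y -> U (x - y).

Definition tvs_complete (R : realType) (X : topologicalLmodType R) : Prop :=
  forall F : set_system X, ProperFilter F -> tvs_cauchy F ->
    exists l : X, F --> l.

(* The topology of [X] is the one defined by the seminorms [p k]: finite
   intersections of open balls form a base of neighbourhoods of each point. *)
Definition topology_of_seminorms (R : realType) (X : topologicalLmodType R)
    (p : nat -> X -> R) : Prop :=
  forall (x : X) (U : set X), nbhs x U <->
    exists (n : nat) (e : R), 0 < e /\
      [set y | forall k, (k <= n)%N -> p k (y - x) < e] `<=` U.

(* Real scalars; a complex space is covered by restriction of scalars. *)
Record graded_frechet (R : realType) (X : topologicalLmodType R)
    (p : nat -> X -> R) : Prop := {
  gf_seminorm : forall k, seminorm (p k) ;
  gf_increasing : forall k x, p k x <= p k.+1 x ;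
  gf_topology : topology_of_seminorms p ;
  gf_hausdorff : hausdorff_space X ;
  gf_complete : tvs_complete X }.

Definition gball (R : realType) (X : lmodType R) (p : nat -> X -> R)
    (x0 : X) (r : nat -> \bar R) : set X :=
  [set x | forall k, ((p k (x0 - x))%:E <= r k)%E].

(* [rbar r alpha delta L LD k] stands for the radius of index [k + LD];
   it is [+oo] as soon as [r (k + L)] is, since the factor is positive when
   [alpha k < 1] and [0 < delta (k + LD)]. *)
Definition rbar (R : realType) (r : nat -> \bar R) (alpha delta : nat -> R)
    (L LD : nat) (k : nat) : \bar R :=
  (r (k + L)%N * ((1 - alpha k) / delta (k + LD)%N)%:E)%E.

(* The map [f] is only relevant on the ball around [x0]: functions with domain
   a ball are represented by total functions with arbitrary values outside. *)
Definition Pmap (R : realType) (X Y : lmodType R) (D : Y -> X) (f : X -> Y)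
    (y : Y) (x : X) : X := x - D (f x - y).

(* Main.v *)
(** A Newton-like iteration with a fixed approximate right inverse: [P y] shifts
    [x] by [D (f x - y)], so [f x_n - y = S (x_n - x_(n+1))] for the iterates
    [x_n] of [P y] at [x0].  Summability of the increments in every seminorm
    makes [x_n] converge to some [l] in the ball; [f] is continuous there, since
    [f = S \o D \o f] and [D \o f] is close to the identity, hence [f l = y]. *)

Require Import Defs.
From mathcomp Require Import all_boot all_order all_algebra.
From mathcomp Require Import all_classical all_reals all_analysis.
From mathcomp Require Import ring lra.

Import Order.TTheory GRing.Theory Num.Theory.
Import numFieldNormedType.Exports.

Local Open Scope classical_set_scope.
Local Open Scope ring_scope.

Section Seminorm.
Context {R : realType} {X : lmodType R} {p : X -> R} (sp : seminorm p).

Lemma seminorm_ge0 x : 0 <= p x.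
Proof. by case: sp. Qed.

Lemma seminormD x y : p (x + y) <= p x + p y.
Proof. by case: sp. Qed.

Lemma seminorm0 : p 0 = 0.
Proof. by case: sp => _ _ /(_ 0 0); rewrite scale0r normr0 mul0r. Qed.

Lemma seminormN x : p (- x) = p x.
Proof. by case: sp => _ _ /(_ (-1) x); rewrite scaleN1r normrN1 mul1r. Qed.

Lemma seminormBC x y : p (x - y) = p (y - x).
Proof. by rewrite -seminormN opprB. Qed.

Lemma seminorm_triangle z x y : p (x - y) <= p (x - z) + p (z - y).
Proof. by apply: le_trans (seminormD _ _); rewrite addrA subrK. Qed.

Lemma seminorm_telescope (u : nat -> X) {m n} : (m <= n)%N ->
  p (u n - u m) <= \sum_(m <= j < n) p (u j.+1 - u j).
Proof.
elim: n => [|n IH].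
  by rewrite leqn0 => /eqP ->; rewrite big_geq// subrr seminorm0.
rewrite leq_eqVlt => /predU1P[->|]; first by rewrite big_geq// subrr seminorm0.
rewrite ltnS => mn; rewrite big_nat_recr//= addrC.
by apply: le_trans (seminorm_triangle (u n) _ _) _; rewrite lerD2l IH.
Qed.

End Seminorm.

Section GradedFrechet.
Context {R : realType} {X : topologicalLmodType R} {p : nat -> X -> R}.
Hypothesis gf : graded_frechet p.

Lemma graded_le {m n} x : (m <= n)%N -> p m x <= p n x.
Proof.
move=> mn; rewrite -(subnK mn); elim: (n - m)%N => [//|i IH].
by apply: le_trans IH _; rewrite addSn (gf_increasing gf).
Qed.

(** If all seminorms vanish at [x], then every neighbourhood of [x] contains [0], so the two points
    cannot be told apart and the Hausdorff property identifies them. *)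
Lemma graded_frechet_separated x : (forall k, p k x = 0) -> x = 0.
Proof.
move=> px0; apply: (gf_hausdorff gf) => A B xA B0.
have /(gf_topology gf)[n [e [e0 sA]]] := xA.
exists 0; split; last exact: nbhs_singleton B0.
by apply: sA => k _; rewrite sub0r (seminormN (gf_seminorm gf k)) px0.
Qed.

(** Bounded sums of increments make [u] Cauchy in each seminorm by telescoping; completeness,
    applied to the image under [u] of the eventual filter, gives the limit. *)
Lemma graded_frechet_cvg (u : nat -> X) :
  (forall k, exists B, forall n, \sum_(0 <= j < n) p k (u j.+1 - u j) <= B) ->
  exists l, forall k e, 0 < e ->
    exists N, forall n, (N <= n)%N -> p k (u n - l) < e.
Proof.
move=> bnd.
have tail k e : 0 < e -> exists N, forall n, (N <= n)%N -> p k (u n - u N) < e.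
  move=> e0; pose s n := \sum_(0 <= j < n) p k (u j.+1 - u j).
  have s_split m n : (m <= n)%N ->
      s n = s m + \sum_(m <= j < n) p k (u j.+1 - u j).
    by move=> mn; rewrite /s (big_cat_nat (n := m)).
  have s_nd : nondecreasing_seq s.
    move=> m n mn; rewrite (s_split _ _ mn) lerDl.
    by apply: sumr_ge0 => j _; exact: seminorm_ge0 (gf_seminorm gf k) _.
  have s_cvg : cvgn s.
    apply: nondecreasing_is_cvgn => //; have [B sB] := bnd k.
    by exists B => _ [n _ <-]; exact: sB.
  (* From [N] on the partial sums lie between [limn s - e] (excluded) and [limn s], so any block of
     increments starting at [N] sums to less than [e]. *)
  have [N _ sN] := cvgr_gt _ s_cvg (limn s - e) ltac:(by rewrite ltrBlDr ltrDl).
  exists N => n Nn.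
  apply: le_lt_trans (seminorm_telescope (gf_seminorm gf k) u Nn) _.
  have := sN N (leqnn N); have := nondecreasing_cvgn_le s_nd s_cvg n.
  rewrite (s_split _ _ Nn) /=; lra.
have [|l ul] := gf_complete gf (fmap_proper_filter u eventually_filter).
  move=> U /(gf_topology gf)[n [e [e0 sU]]].
  have [N uN] := tail n (e / 2) ltac:(by rewrite divr_gt0).
  (* The seminorms increase with the index, so smallness in the top one, [p n], controls all
     [k <= n]. *)
  exists [set x | p n (x - u N) < e / 2]; first by exists N => //= m /uN.
  move=> x y /= xN yN; apply: sU => k kn; rewrite subr0.
  apply: le_lt_trans (graded_le _ kn) _.
  apply: le_lt_trans (seminorm_triangle (gf_seminorm gf n) (u N) _ _) _.
  by rewrite (seminormBC (gf_seminorm gf n) (u N)) [e]splitr ltrD.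
exists l => k e e0.
have /ul[N _ uN] : nbhs l [set y | p k (y - l) < e].
  by apply/(gf_topology gf); exists k, e; split=> // y; apply.
by exists N => n /uN.
Qed.

End GradedFrechet.

(** Membership is tested one seminorm at a time, so the approximating index may depend on [k].
    Adding an arbitrary [e] on the side of the radius treats finite and infinite radii alike. *)
Lemma gball_closed {R : realType} {X : lmodType R} (p : nat -> X -> R)
    (x0 : X) (r : nat -> \bar R) (u : nat -> X) (l : X) :
  (forall k, seminorm (p k)) ->
  (forall n, gball p x0 r (u n)) ->
  (forall k e, 0 < e -> exists n, p k (u n - l) < e) ->
  gball p x0 r l.
Proof.
move=> sp uB ul k; apply/lee_addgt0Pr => e /(ul k)[n une].
apply: (@le_trans _ _ ((p k (x0 - u n))%:E + e%:E)%E); last by rewrite leeD2r ?uB.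
rewrite -EFinD lee_fin; apply: le_trans (seminorm_triangle (sp k) (u n) _ _) _.
by rewrite lerD2l ltW.
Qed.

(** Turns summability in the extended reals, as in (vii), into the real bound that
    [graded_frechet_cvg] expects. *)
Lemma partial_sum_bounded {R : realType} (a : nat -> R) :
  (forall n, 0 <= a n) -> (\sum_(0 <= n <oo) (a n)%:E < +oo)%E ->
  exists B, forall n, \sum_(0 <= j < n) a j <= B.
Proof.
move=> a0 alt; exists (fine (\sum_(0 <= n <oo) (a n)%:E)%E) => n.
rewrite -lee_fin fineK -?sumEFin; last first.
  by rewrite ge0_fin_numE// nneseries_ge0// => j _ _; rewrite lee_fin.
by apply: nneseries_lim_ge => j _; rewrite lee_fin.
Qed.

Theorem theorem6 (R : realType) (X Y : topologicalLmodType R)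
  (pX : nat -> X -> R) (pY : nat -> Y -> R)
  (gfX : graded_frechet pX) (gfY : graded_frechet pY)
  (x0 : X) (r : nat -> \bar R) (r_gt0 : forall k, (0 < r k)%E)
  (L LS LD : nat) (alpha sigma delta : nat -> R) (alphan : nat -> nat -> R)
  (alpha01 : forall k, 0 < alpha k < 1)
  (sigma_gt0 : forall k, 0 < sigma k)
  (delta_gt0 : forall k, 0 < delta k)
  (alphan_gt0 : forall k n, 0 < alphan k n)
  (D : {linear Y -> X}) (S : {linear X -> Y}) (f : X -> Y)
  (BX : set X) (BX_def : BX = gball pX x0 r)
  (BY : set Y)
  (BY_def : BY = gball (fun k => pY (k + LD)%N) (f x0)
                   (rbar r alpha delta L LD))
  (P : Y -> X -> X) (P_def : P = Pmap D f)
  (hi : forall k x x', BX x -> BX x' ->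
     pX k (D (f x) - D (f x') - (x - x')) <= alpha k * pX (k + L)%N (x - x'))
  (hii : forall y, S (D y) = y)
  (hiii : forall k x x',
     pY k (S x - S x') <= sigma k * pX (k + LS)%N (x - x'))
  (hiv : forall k y y',
     pX k (D y - D y') <= delta (k + LD)%N * pY (k + LD)%N (y - y')) :
  [/\
    (* main part *)
    (forall k n y, BY y ->
       pX k (iter n.+1 (P y) x0 - iter n (P y) x0)
         <= alphan k n * pX (k + n * L)%N (P y x0 - x0)) (* (v) *) ->
    (forall n y, BY y -> BX (iter n (P y) x0)) (* (vi) *) ->
    (forall k y, BY y ->
       (\sum_(0 <= n <oo)
          (alphan k n * pX (k + n * L)%N (P y x0 - x0))%:E < +oo)%E)
      (* (vii) *) ->
    [/\ (* (viii) *)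
        forall k x x', BX x -> BX x' ->
          pY k (f x - f x')
            <= sigma k * (alpha (k + LS)%N * pX (k + LS + L)%N (x - x')
                          + pX (k + LS)%N (x - x')),
        (* (ix) *)
        forall k x x', BX x -> BX x' ->
          (delta (k + LD)%N)^-1
              * (pX k (x - x') - alpha k * pX (k + L)%N (x - x'))
            <= pY (k + LD)%N (f x - f x'),
        (* (x) *)
        forall y, BY y -> exists2 x, BX x & f x = y
      & (* (xi) *)
        forall (g : Y -> X) (N : X -> R),
          (forall y, BY y -> BX (g y)) ->
          (forall y, BY y -> f (g y) = y) ->
          (forall k x, pX k x = N x) ->
          forall k y y', BY y -> BY y' ->
            N (g y - g y')
              <= delta (k + LD)%N / (1 - alpha k) * pY (k + LD)%N (y - y')],
    (* 1) *)
    (forall k, (r (k + L)%N <= r k)%E) ->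
      (forall y, BY y -> forall x, BX x -> BX (P y x)) /\
      (forall n y, BY y -> BX (iter n (P y) x0))
  & (* 2) *)
    (forall k n, alphan k n = \prod_(0 <= j < n) alpha (k + j * L)%N) ->
    (forall n y, BY y -> BX (iter n (P y) x0)) ->
    forall k n y, BY y ->
       pX k (iter n.+1 (P y) x0 - iter n (P y) x0)
         <= alphan k n * pX (k + n * L)%N (P y x0 - x0)].
Proof.
have spX := gf_seminorm gfX; have spY := gf_seminorm gfY.
have PE y x : P y x = x - D (f x - y) by rewrite P_def.
have S_le k x : pY k (S x) <= sigma k * pX (k + LS)%N x.
  by have := hiii k x 0; rewrite linear0 !subr0.
have D_le k y : pX k (D y) <= delta (k + LD)%N * pY (k + LD)%N y.
  by have := hiv k y 0; rewrite linear0 !subr0.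
have x0B : BX x0.
  by rewrite BX_def => k; rewrite subrr (seminorm0 (spX k)) ltW.
(* By (ii), [f x - f x'] is [S] of [D (f x) - D (f x')], which is [x - x'] plus the defect estimated
   in (i). *)
have f_lip k x x' : BX x -> BX x' -> pY k (f x - f x')
    <= sigma k * (alpha (k + LS)%N * pX (k + LS + L)%N (x - x')
                  + pX (k + LS)%N (x - x')).
  move=> xB x'B; rewrite -(hii (f x - f x')) linearB/=.
  apply: le_trans (S_le _ _) _; rewrite ler_pM2l// -{1}(subrK (x - x') (D _ - D _)).
  by apply: le_trans (seminormD (spX _) _ _) _; rewrite lerD2r hi.
(* Reverse triangle inequality: [D (f x) - D (f x')] differs from [x - x'] by the defect in (i).
   This division-free form of (ix) also yields (xi). *)
have f_colip k x x' : BX x -> BX x' ->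
    pX k (x - x') - alpha k * pX (k + L)%N (x - x')
      <= delta (k + LD)%N * pY (k + LD)%N (f x - f x').
  move=> xB x'B; apply: le_trans (hiv _ _ _).
  rewrite lerBlDl -[leLHS](seminormN (spX k)).
  have -> : - (x - x') = D (f x) - D (f x') - (x - x') - (D (f x) - D (f x')).
    by rewrite addrAC subrr add0r.
  apply: le_trans (seminormD (spX k) _ _) _.
  by rewrite (seminormN (spX k)) lerD2r hi.
(* The terms in [y] cancel: a difference of values of [P y] is exactly minus the defect in (i). *)
have P_contr y k x x' : BX x -> BX x' ->
    pX k (P y x - P y x') <= alpha k * pX (k + L)%N (x - x').
  move=> xB x'B; apply: le_trans (hi k x x' xB x'B).
  have -> : P y x - P y x' = - (D (f x) - D (f x') - (x - x')).
    rewrite !PE !(linearB D)/= !(opprB _ (D y)) !(addrCA _ (D y)).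
    by rewrite opprD addrACA subrr add0r opprD addrACA -opprD !opprB.
  by rewrite (seminormN (spX k)).
split.
- move=> hv hvi hvii; split => //.
  + by move=> k x x' xB x'B; rewrite mulrC ler_pdivrMr// [leRHS]mulrC f_colip.
  + move=> y yB; pose u n := iter n (P y) x0.
    have uB n : BX (u n) by exact: hvi.
    have [k|l ul] := graded_frechet_cvg gfX u.
      have [j|B sB] := partial_sum_bounded _ _ (hvii k y yB).
        by rewrite mulr_ge0 ?(seminorm_ge0 (spX _))// ltW.
      exists B => n; apply: le_trans (sB n).
      by apply: ler_sum => j _; exact: hv.
    (* The limit must lie in the ball before [f_lip] can be applied at [l]. *)
    have lB : BX l.
      rewrite BX_def; apply: (@gball_closed _ _ _ _ _ u) => //.
        by move=> n; rewrite -BX_def.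
      by move=> k e /(ul k)[N /(_ N (leqnn N))]; exists N.
    exists l => //; apply/eqP; rewrite -subr_eq0; apply/eqP.
    apply: (graded_frechet_separated gfY) => k.
    apply/eqP; rewrite eq_le (seminorm_ge0 (spY k)) andbT.
    apply/ler_addgt0Pr => e e0; rewrite add0r.
    have s0 := sigma_gt0 k.
    (* The factor 4 counts the errors: [f l - f (u N)] costs two, as [alpha (k + LS) < 1], and
       [S (u N - u N.+1)] costs two more through [l]. The index [k + LS + L] dominates all those
       that occur. *)
    have [N uN] := ul (k + LS + L)%N (e / (4 * sigma k))
      ltac:(by rewrite divr_gt0// mulr_gt0).
    have := uN N (leqnn N); have := uN N.+1 (leqnSn N).
    set d := e / _ => u1 u0.
    have de : sigma k * (4 * d) = e.
      by rewrite /d; field; rewrite gt_eqF.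
    have uNy : f (u N) - y = S (u N - u N.+1).
      by rewrite /u iterS PE subKr hii.
    apply: le_trans (seminorm_triangle (spY k) (f (u N)) _ _) _.
    apply: le_trans (lerD (f_lip k _ _ lB (uB N)) _) _.
      by rewrite uNy; exact: S_le.
    rewrite -mulrDr -de ler_pM2l//.
    have := seminorm_triangle (spX (k + LS)%N) l (u N) (u N.+1).
    rewrite (seminormBC (spX (k + LS)%N) l) (seminormBC (spX (k + LS)%N) l).
    rewrite (seminormBC (spX (k + LS + L)%N) l).
    have := graded_le gfX (u N - l) (leq_addr L (k + LS)).
    have := graded_le gfX (u N.+1 - l) (leq_addr L (k + LS)).
    have aK : alpha (k + LS)%N * pX (k + LS + L)%N (u N - l)
        <= pX (k + LS + L)%N (u N - l).
      apply: ler_piMl; first exact: seminorm_ge0.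
      by case/andP: (alpha01 (k + LS)%N) => _ /ltW.
    lra.
  + move=> g N gB fg pN k y y' yB y'B.
    have /andP[_ a1] := alpha01 k.
    (* With a single norm the shift by [L] disappears, so the left side of [f_colip] becomes
       [1 - alpha k] times the norm of the difference, and this factor is positive. *)
    have := f_colip k _ _ (gB _ yB) (gB _ y'B); rewrite !fg// !pN.
    rewrite mulrAC ler_pdivlMr ?subr_gt0//; lra.
- move=> rL.
  have PB y : BY y -> forall x, BX x -> BX (P y x).
    rewrite BY_def BX_def => yB x xB k; apply: le_trans (rL k).
    have xB' : BX x by rewrite BX_def.
    have /andP[_ a1] := alpha01 k.
    have := yB k; rewrite /rbar; have := xB (k + L)%N.
    case: (r (k + L)%N) => [c| |]; rewrite ?leey// -?EFinM ?lee_fin// => xc yc.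
    (* For a finite radius [c] of index [k + L], the first step from [x0] costs at most
       [c * (1 - alpha k)], by the choice of [rbar], and the contraction at most [alpha k * c]; the
       total is [c]. *)
    apply: le_trans (seminorm_triangle (spX k) (P y x0) _ _) _.
    rewrite {1}PE subKr.
    have := P_contr y k _ _ x0B xB'.
    have := D_le k (f x0 - y).
    have /andP[a0 _] := alpha01 k.
    have := ler_wpM2l (ltW a0) xc.
    have := ler_wpM2l (ltW (delta_gt0 (k + LD)%N)) yc.
    have -> : delta (k + LD)%N * (c * ((1 - alpha k) / delta (k + LD)%N))
        = c * (1 - alpha k).
      by field; rewrite gt_eqF.
    lra.
  split=> // n y yB; elim: n => [//|n IH]; exact: PB.
(* The induction keeps [k] general because each use of [P_contr] raises the index by [L]; the new
   factor [alpha k] is the first one of the product, the others being shifted. *)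
- move=> ha hvi k n y yB; elim: n k => [|n IH] k.
    by rewrite ha big_geq// mul1r mul0n addn0.
  rewrite iterS [iter n.+1 _ _ in X in _ - X]iterS.
  apply: le_trans (P_contr y k _ _ (hvi n.+1 y yB) (hvi n y yB)) _.
  have /andP[a0 _] := alpha01 k.
  apply: le_trans (ler_wpM2l (ltW a0) (IH (k + L)%N)) _.
  rewrite !ha big_nat_recl//= mul0n addn0 mulrA mulSn addnA.
  rewrite le_eqVlt; apply/orP; left; apply/eqP; congr (_ * _ * _).
  by apply: eq_bigr => j _; rewrite mulSn addnA.
Qed.
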